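(* Let $\mathbf{k}$ be a field, $X=\{x_i\mid i\in I\}$ a well-ordered set, let $[X^+]_\omega$ carry the deg-lex-center ordering, and let $T$ be the subset of $Di\langle X\rangle$ consisting of the polynomials $$[u]_m\vdash[v]_n\vdash[w]_l-[v]_n\vdash[u]_m\vdash[w]_l,\qquad [u]_m\dashv[v]_n\dashv[w]_l-[v]_n\dashv[u]_m\dashv[w]_l,$$ where $[u]_m,[v]_n,[w]_l\in[X^+]_\omega$. Then: (i) $Di\langle X\mid T\rangle=Di\langle X\mid S\rangle$ (i.e. $Id(T)=Id(S)$), where $S$ consists of the nonzero polynomials among $$[uxv]_{|u|+1}-[\lfloor u\rfloor xv]_{|u|+1}\quad(u,v\in X^*,\ x\in X,\ |u|\ge2,\ |v|\le1),$$ $$[uxvy]_{|u|+1}-[\lfloor uxv\rfloor y]_1\quad(u,v\in X^*,\ x,y\in X,\ |v|\ge1).$$ (ii) $S$ is a Gröbner-Shirshov basis in $Di\langle X\rangle$. (iii) The set $$\{[x_{i_1}\cdots x_{i_n}]_1\mid x_{i_1}\le\cdots\le x_{i_{n-1}},\ x_{i_l}\in X,\ 1\le l\le n,\ n\in\mathbb{Z}^+\}$$ $$\cup\ \{[x_{j_1}\cdots x_{j_m}u]_m\mid x_{j_1}\le\cdots\le x_{j_{m-1}},\ x_{j_k}\in X,\ 1\le k\le m,\ m\in\mathbb{Z}^+,\ u\in X^*,\ |u|\le1\}$$ is a $\mathbf{k}$-basis of the dialgebra $Di\langle X\mid T\rangle$ and is a set of normal forms of elements of the free left commutative disemigroup $Disgp\langle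 X\mid T\rangle$ (i.e. every element of that disemigroup is the class of exactly one element of the set).
   Context: Free dialgebra and disemigroup. A dialgebra over $\mathbf{k}$ (resp. a disemigroup) is a $\mathbf{k}$-module with two $\mathbf{k}$-bilinear associative products (resp. a set with two associative operations) $\vdash,\dashv$ satisfying $a\dashv(b\vdash c)=a\dashv(b\dashv c)$, $(a\dashv b)\vdash c=(a\vdash b)\vdash c$, $a\vdash(b\dashv c)=(a\vdash b)\dashv c$. A disemigroup is left commutative if $a\dashv b\dashv c=b\dashv a\dashv c$ and $a\vdash b\vdash c=b\vdash a\vdash c$ for all $a,b,c$. $X^+$ is the set of nonempty words on $X$, $X^*$ the set of all words including the empty one, $|u|$ the length of $u$. $[X^+]_\omega=\{[u]_m\mid u\in X^+,\ 1\le m\le |u|\}$ is the set of normal diwords (formal pairs $(u,m)$); $u$ is the associative word and $p([u]_m)=m$ the position of center. With $[u]_m\vdash[v]_n=[uv]_{|u|+n}$, $[u]_m\dashv[v]_n=[uv]_m$ it is the free disemigroup on $X$, and the $\mathbf{k}$-space $Di\langle X\rangle$ with basis $[X^+]_\omega$ and these products extended bilinearly is the free dialgebra ($x\in X$ is identified with $[x]_1$). An ideal is a subspace closed under both products, on both sides, with arbitrary elements; $Id(S)$ is the ideal generated by $S$, $Di\langle X\mid S\rangle=Di\langle X\rangle/Id(S)$. $Disgp\langle X\mid T\rangle$ is the quotient of the disemigroup $[X^+]_\omega$ by the congruence generated by the pairs of diwords whose differences form $T$; it is the free left commutative disemigroup generated by $X$. For $u\in X^*$, $\lfloor u\rfloor$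 is the word obtained by rearranging the letters of $u$ in non-decreasing order. A subset of $[X^+]_\omega$ is said to be a basis of a quotient if the images of its elements are distinct and form a basis. Orderings. The deg-lex ordering on $X^+$ compares words first by length and then lexicographically from the left. The deg-lex-center ordering on $[X^+]_\omega$: $[u]_m>[v]_n$ iff $(u,m)>(v,n)$ lexicographically (words compared by deg-lex). For $0\ne f\in Di\langle X\rangle$: $\overline f$ is the leading (largest) normal diword of $f$, $lc(f)$ its coefficient, $lt(f)=lc(f)\overline f$, $\widetilde f$ the associative word of $\overline f$, $r_f=f-lt(f)$. By convention $0$ is smaller than every diword and every word, and $\overline 0=\widetilde 0=0$. $f\neq0$ is monic if $lc(f)=1$; a set is monic if all its elements are. $f\ne0$ is strong if $\widetilde f>\widetilde{r_f}$ (in particular if $r_f=0$). Normal $S$-diwords ($S$ monic). For $s\in S$, $a,b\in X^*$ put $P([asb])=\{n: 1\le n\le|a|\}\cup\{|a|+p(\overline s)\}\cup\{n:|a\widetilde s|<n\le|a\widetilde sb|\}$ if $s$ is strong, and $P([asb])=\{|a|+p(\overline s)\}$ if $s$ is not strong. For $l\in P([asb])$ the normal $S$-diword $[asb]_l$ is the element: $[a]_l\dashv s\dashv[b]_1$ if $l\le|a|$; $[a]_{|a|}\vdash s\dashv[b]_1$ if $l=|a|+p(\overline s)$; $[a]_{|a|}\vdash s\vdash[b]_{l-|a\widetilde s|}$ if $l>|a\widetilde s|$ (factors with empty word omitted). One has $\overline{[asb]_l}=[a\widetilde sb]_l$. Compositions of monic $f,g\in Di\langle X\rangle$ (same notation $[afb]_l$,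 $P$ used for single polynomials): 1) If $f$ is not strong: $x\dashv f$ for all $x\in X$ and $f\vdash[u]_{|u|}$ for all $u\in X^+$. 2) If $w=\widetilde f=a\widetilde gb$, $a,b\in X^*$: if $p(\overline f)\in P([agb])$, $f-[agb]_{p(\overline f)}$; if $p(\overline f)\notin P([agb])$ and both $f,g$ are strong, for every $x\in X$, $[xf]_1-[xagb]_1$ and $[fx]_{|wx|}-[agbx]_{|wx|}$. 3) If $w=\widetilde fb=a\widetilde g$, $a,b\in X^*$, $|\widetilde f|+|\widetilde g|>|w|$: if $P([fb])\cap P([ag])\ne\varnothing$, for every $m$ in it $[fb]_m-[ag]_m$; if $P([fb])\cap P([ag])=\varnothing$ and both $f,g$ are strong, for every $x\in X$, $[xfb]_1-[xag]_1$ and $[fbx]_{|wx|}-[agx]_{|wx|}$. $h$ is trivial modulo $S$ if $h=\sum\alpha_i[a_is_ib_i]_{m_i}$ is a finite sum with $\alpha_i\in\mathbf{k}$, $[a_is_ib_i]_{m_i}$ normal $S$-diwords and $\overline{[a_is_ib_i]_{m_i}}\le\overline h$. A monic set $S$ is a Gröbner-Shirshov basis in $Di\langle X\rangle$ if every composition of elements of $S$ is trivial modulo $S$. *)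

(* Defs.v *)
From HB Require Import structures.
From mathcomp Require Import all_boot all_order all_algebra.
From mathcomp Require Import finmap monalg.
From mathcomp Require Import boolp classical_sets.

Set Implicit Arguments.
Unset Strict Implicit.
Unset Printing Implicit Defensive.

Import Order.TTheory GRing.Theory.

Local Open Scope ring_scope.

Declare Scope dialgebra_scope.
Delimit Scope dialgebra_scope with dia.
Reserved Notation "f ⊢ g" (at level 40, left associativity).
Reserved Notation "f ⊣ g" (at level 40, left associativity).

Definition well_ordered d (X : orderType d) : Prop :=
  forall A : set X, (A !=set0)%classic ->
    exists2 x, A x & forall y, A y -> (x <= y)%O.

Section Diword.
Variable X : choiceType.

(* [diword X] is the set of normal diwords [u]_m; positions start at 1, and
   1 <= m <= |u| forces u to be nonempty. *)
Record diword := Diword { dipair : seq X * nat; _ : (0 < dipair.2 <= size dipair.1)%N }.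
HB.instance Definition _ := [isSub for dipair].
HB.instance Definition _ := [Choice of diword by <:].

Definition dword (w : diword) : seq X := (dipair w).1.
Definition dpos (w : diword) : nat := (dipair w).2.

Lemma dil_subproof (v w : diword) :
  (0 < size (dword v) + dpos w <= size (dword v ++ dword w))%N.
Proof.
by have /andP[n0 nw] := valP w; rewrite size_cat addn_gt0 n0 orbT leq_add2l.
Qed.

Lemma dir_subproof (v w : diword) :
  (0 < dpos v <= size (dword v ++ dword w))%N.
Proof.
by have /andP[n0 nv] := valP v; rewrite size_cat n0 (leq_trans nv) ?leq_addr.
Qed.

(* [dil] is ⊢ (center in the right factor), [dir] is ⊣. *)
Definition dil (v w : diword) : diword :=
  @Diword (dword v ++ dword w, size (dword v) + dpos w)%N (dil_subproof v w).
Definition dir (v w : diword) : diword :=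
  @Diword (dword v ++ dword w, dpos v) (dir_subproof v w).

End Diword.

Section FreeDialgebra.
Variables (k : fieldType) (X : choiceType).

Definition Di := {malg k[diword X]}.
HB.instance Definition _ := GRing.Lmodule.on Di.

Definition bilin (op : diword X -> diword X -> diword X) (f g : Di) : Di :=
  \sum_(v <- msupp f) \sum_(w <- msupp g) << f@_v * g@_w *g op v w >>.

Definition Dil : Di -> Di -> Di := bilin (@dil X).
Definition Dir : Di -> Di -> Di := bilin (@dir X).
Local Notation "f ⊢ g" := (Dil f g).
Local Notation "f ⊣ g" := (Dir f g).

(* [mon u m] is the basis element [u]_m; it is only used for 1 <= m <= |u|. *)
Definition mon (u : seq X) (m : nat) : Di :=
  if insub (u, m) is Some w then << w >> else 0.

Definition is_ideal (I : set Di) : Prop :=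
  [/\ I 0,
      forall (a : k) f g, I f -> I g -> I (a *: f + g) &
      forall f g, I f -> [/\ I (f ⊢ g), I (g ⊢ f), I (f ⊣ g) & I (g ⊣ f)]].

Definition Id (S : set Di) : set Di :=
  [set f | forall I : set Di, is_ideal I -> (S `<=` I)%classic -> I f].

Lemma Id_is_ideal (S : set Di) : is_ideal (Id S).
Proof.
split=> [I [I0 _ _] _ //|a f g If Ig I idI SI|f g If].
  by case: (idI) => _ + _; apply; [exact: If|exact: Ig].
by split=> I idI SI; case: (idI) => _ _ /(_ f g (If I idI SI)) [].
Qed.

Section Quotient.
Variable S : set Di.

Definition Idb (f : Di) : bool := `[< Id S f >].

Lemma Idb_zmod_closed : zmod_closed Idb.
Proof.
have [I0 IZ _] := Id_is_ideal S; split; first exact/asboolP.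
move=> f g /asboolP If /asboolP Ig; apply/asboolP.
by rewrite addrC -scaleN1r; apply: IZ.
Qed.
HB.instance Definition _ := GRing.isZmodClosed.Build Di Idb Idb_zmod_closed.

(* The k-module underlying Di<X | S>, with projection \pi from Di. *)
Definition Di_quot := Quotient.quot (GRing.ZmodClosed.clone Di Idb _).
HB.instance Definition _ := GRing.Zmodule.on Di_quot.
HB.instance Definition _ := ZmodQuotient.on Di_quot.

Local Open Scope quotient_scope.

Definition scaleq (a : k) := lift_op1 Di_quot ( *:%R a).

Lemma pi_eqP (f g : Di) : \pi_Di_quot f = \pi_Di_quot g <-> Id S (f - g).
Proof.
split=> [/eqP|Ifg]; first by rewrite -Quotient.idealrBE => /asboolP.
by apply/eqP; rewrite -Quotient.idealrBE; apply/asboolP.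
Qed.

Lemma pi_scaleq a : {morph \pi_Di_quot : f / a *: f >-> scaleq a f}.
Proof.
move=> f; unlock scaleq; apply/pi_eqP; have [I0 IZ _] := Id_is_ideal S.
rewrite -scalerBr -[_ *: _]addr0; apply: IZ => //.
by apply/pi_eqP; rewrite reprK.
Qed.

Fact scaleqA a b q : scaleq a (scaleq b q) = scaleq (a * b) q.
Proof. by rewrite -[q]reprK -!pi_scaleq scalerA. Qed.
Fact scale1q : left_id 1 scaleq.
Proof. by move=> q; rewrite -[q]reprK -!pi_scaleq scale1r. Qed.
Fact scaleqDr : right_distributive scaleq +%R.
Proof.
by move=> a p q; rewrite -[p]reprK -[q]reprK -raddfD -!pi_scaleq -raddfD scalerDr.
Qed.
Fact scaleqDl q : {morph scaleq^~ q : a b / a + b}.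
Proof. by move=> a b; rewrite -[q]reprK -!pi_scaleq -raddfD scalerDl. Qed.

HB.instance Definition _ :=
  GRing.Zmodule_isLmodule.Build k Di_quot scaleqA scale1q scaleqDr scaleqDl.

Definition is_congruence (R : diword X -> diword X -> Prop) : Prop :=
  [/\ forall v, R v v,
      forall v w, R v w -> R w v,
      forall v w z, R v w -> R w z -> R v z &
      forall v v' w w', R v v' -> R w w' ->
        R (dil v w) (dil v' w') /\ R (dir v w) (dir v' w')].

Definition Cong (v w : diword X) : Prop :=
  forall R, is_congruence R -> (forall p q, S (<< p >> - << q >>) -> R p q) ->
    R v w.

Definition congb : rel (diword X) := fun v w => `[< Cong v w >].

Lemma congb_equiv : equiv_class_of congb.
Proof.
split=> [v|v w|w v z].
- by apply/asboolP => R [].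
- by apply/asboolP/asboolP => C R cR SR; case: (cR) => _ + _ _; apply; apply: C.
- move=> /asboolP vw /asboolP wz; apply/asboolP => R cR SR.
  by case: (cR) => _ _ + _; apply; [exact: vw|exact: wz].
Qed.
Canonical congb_equiv_rel := EquivRelPack congb_equiv.
Canonical congb_encModRel := defaultEncModRel congb.

(* The set underlying Disgp<X | S>. *)
Definition Disgp := {eq_quot congb}.
HB.instance Definition _ := Choice.on Disgp.
HB.instance Definition _ := EqQuotient.on Disgp.

End Quotient.
End FreeDialgebra.

Notation "f ⊢ g" := (Dil f g) : dialgebra_scope.
Notation "f ⊣ g" := (Dir f g) : dialgebra_scope.

Section GroebnerShirshov.
Variables (k : fieldType) (d : Order.disp_t) (X : orderType d).
Local Notation Di := (Di k X).
Local Open Scope dialgebra_scope.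

Definition deglex_lt (u v : seq X) : bool :=
  (size u < size v)%N || (size u == size v) && ((u : seqlexi X) < v)%O.

Definition dcenter_lt (v w : diword X) : bool :=
  deglex_lt (dword v) (dword w) || (dword v == dword w) && (dpos v < dpos w)%N.
Definition dcenter_le (v w : diword X) : bool := (v == w) || dcenter_lt v w.

(* The leading diword; [None] plays the role of the leading diword 0 of 0. *)
Definition lead (f : Di) : option (diword X) :=
  ohead [seq w <- msupp f | all (dcenter_le^~ w) (msupp f)].
Definition lead_le (v w : option (diword X)) : bool :=
  match v, w with
  | None, _ => true
  | Some _, None => false
  | Some v, Some w => dcenter_le v w
  end.

(* For f = 0 the value [::] plays the role of 0: it is deg-lex smaller than
   every nonempty word. *)
Definition lword (f : Di) : seq X := oapp (@dword X) [::] (lead f).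
Definition lpos (f : Di) : nat := oapp (@dpos X) 0%N (lead f).
Definition lc (f : Di) : k := oapp (mcoeff^~ f) 0 (lead f).
Definition lterm (f : Di) : Di := oapp (fun w => << lc f *g w >>) 0 (lead f).
Definition rest (f : Di) : Di := f - lterm f.

(* As 1 != 0, monic polynomials are nonzero. *)
Definition monic (f : Di) : Prop := lc f = 1.
Definition strong (f : Di) : bool :=
  (f != 0) && deglex_lt (lword (rest f)) (lword f).

(* [Pset s a b l] means that l lies in P([asb]). *)
Definition Pset (s : Di) (a b : seq X) (l : nat) : bool :=
  (l == size a + lpos s)%N ||
  strong s && ((1 <= l <= size a)%N ||
    (size (a ++ lword s) < l <= size (a ++ lword s ++ b))%N).

(* Multiplication by [u]_m, omitted when u is empty. *)
Definition lmull (u : seq X) (m : nat) (f : Di) : Di :=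
  if u is [::] then f else mon k u m ⊢ f.
Definition lmulr (u : seq X) (m : nat) (f : Di) : Di :=
  if u is [::] then f else mon k u m ⊣ f.
Definition rmull (f : Di) (u : seq X) (m : nat) : Di :=
  if u is [::] then f else f ⊢ mon k u m.
Definition rmulr (f : Di) (u : seq X) (m : nat) : Di :=
  if u is [::] then f else f ⊣ mon k u m.

(* [nsd a s b l] is [asb]_l; it is only used for l in P([asb]), so that the
   second case is l = |a| + p(s). *)
Definition nsd (a : seq X) (s : Di) (b : seq X) (l : nat) : Di :=
  if (l <= size a)%N then rmulr (lmulr a l s) b 1
  else if (l <= size (a ++ lword s))%N then rmulr (lmull a (size a) s) b 1
  else rmull (lmull a (size a) s) b (l - size (a ++ lword s)).

(* [composition f g h]: h is a composition of f and g. *)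
Inductive composition (f g : Di) : Di -> Prop :=
| Comp1r (x : X) : ~~ strong f -> composition f g (mon k [:: x] 1 ⊣ f)
| Comp1l (u : seq X) : ~~ strong f -> u != [::] ->
    composition f g (f ⊢ mon k u (size u))
| Comp2 (a b : seq X) : lword f = a ++ lword g ++ b -> Pset g a b (lpos f) ->
    composition f g (f - nsd a g b (lpos f))
| Comp2l (a b : seq X) (x : X) : lword f = a ++ lword g ++ b ->
    ~~ Pset g a b (lpos f) -> strong f -> strong g ->
    composition f g (nsd [:: x] f [::] 1 - nsd (x :: a) g b 1)
| Comp2r (a b : seq X) (x : X) : lword f = a ++ lword g ++ b ->
    ~~ Pset g a b (lpos f) -> strong f -> strong g ->
    composition f g (nsd [::] f [:: x] (size (lword f)).+1 -
                     nsd a g (rcons b x) (size (lword f)).+1)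
| Comp3 (a b : seq X) (m : nat) : lword f ++ b = a ++ lword g ->
    (size (lword f) + size (lword g) > size (lword f ++ b))%N ->
    Pset f [::] b m -> Pset g a [::] m ->
    composition f g (nsd [::] f b m - nsd a g [::] m)
| Comp3l (a b : seq X) (x : X) : lword f ++ b = a ++ lword g ->
    (size (lword f) + size (lword g) > size (lword f ++ b))%N ->
    (forall m, ~~ (Pset f [::] b m && Pset g a [::] m)) ->
    strong f -> strong g ->
    composition f g (nsd [:: x] f b 1 - nsd (x :: a) g [::] 1)
| Comp3r (a b : seq X) (x : X) : lword f ++ b = a ++ lword g ->
    (size (lword f) + size (lword g) > size (lword f ++ b))%N ->
    (forall m, ~~ (Pset f [::] b m && Pset g a [::] m)) ->
    strong f -> strong g ->
    composition f g (nsd [::] f (rcons b x) (size (lword f ++ b)).+1 -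
                     nsd a g [:: x] (size (lword f ++ b)).+1).

Definition trivial_mod (S : set Di) (h : Di) : Prop :=
  exists (n : nat) (alpha : 'I_n -> k) (a b : 'I_n -> seq X) (s : 'I_n -> Di)
         (m : 'I_n -> nat),
    (forall i, [/\ S (s i), Pset (s i) (a i) (b i) (m i) &
                   lead_le (lead (nsd (a i) (s i) (b i) (m i))) (lead h)]) /\
    h = \sum_i alpha i *: nsd (a i) (s i) (b i) (m i).

Definition GS_basis (S : set Di) : Prop :=
  (forall s, S s -> monic s) /\
  (forall f g h, S f -> S g -> composition f g h -> trivial_mod S h).

End GroebnerShirshov.

(* The vectors [e i], for i in N, are pairwise distinct and form a basis of V. *)
Definition is_basis (k : fieldType) (V : lmodType k) (I : eqType) (N : set I)
    (e : I -> V) : Prop :=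
  [/\ forall i j, N i -> N j -> e i = e j -> i = j,
      forall v : V, exists (r : seq I) (c : I -> k),
        (forall i, i \in r -> N i) /\ v = \sum_(i <- r) c i *: e i &
      forall (r : seq I) (c : I -> k), uniq r -> (forall i, i \in r -> N i) ->
        \sum_(i <- r) c i *: e i = 0 -> forall i, i \in r -> c i = 0].

Section LeftCommutative.
Variables (k : fieldType) (d : Order.disp_t) (X : orderType d).
Local Notation Di := (Di k X).
Local Open Scope dialgebra_scope.

Definition T_lc : set Di :=
  [set f | exists u v w : diword X,
     f = << u >> ⊢ << v >> ⊢ << w >> - << v >> ⊢ << u >> ⊢ << w >> \/
     f = << u >> ⊣ << v >> ⊣ << w >> - << v >> ⊣ << u >> ⊣ << w >>].

Definition nondecr (u : seq X) : seq X := sort <=%O u.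

Definition S_lc : set Di :=
  [set f | f <> 0 /\
    ((exists u v x, [/\ (2 <= size u)%N, (size v <= 1)%N &
        f = mon k (u ++ x :: v) (size u).+1 -
            mon k (nondecr u ++ x :: v) (size u).+1]) \/
     (exists u v x y, (1 <= size v)%N /\
        f = mon k (u ++ x :: rcons v y) (size u).+1 -
            mon k (rcons (nondecr (u ++ x :: v)) y) 1))].

(* In both families the nondecreasing letters are s and x is the next one. *)
Definition N_lc : set (diword X) :=
  [set w | (exists s x, [/\ sorted <=%O s, dword w = rcons s x & dpos w = 1%N]) \/
           (exists s x u, [/\ sorted <=%O s, (size u <= 1)%N,
              dword w = s ++ x :: u & dpos w = (size s).+1])].

End LeftCommutative.

Arguments T_lc k {d} X _.
Arguments S_lc k {d} X _.
Arguments N_lc {d} X _.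

(* Main.v *)
(** Let [nf] send a diword [[u]_m] with [m <= |u| - 2] to the diword with center 1
whose first [|u| - 1] letters are sorted, and any other diword to the one with
its first [m - 1] letters sorted and the same center.  Then
[S = { w - nf w | nf w <> w }], and the kernel of the linear extension of [nf]
is an ideal equal to both [Id(S)] and [Id(T)]: it contains [T] because [nf]
identifies the two sides of each left commutativity relation, and conversely
block swaps generate all permutations, so every congruence containing the
relations relates [w] to [nf w].  An element [h = \sum_w h_w w] of that kernel
equals [\sum_w h_w (w - nf w)], and [w - nf w] has leading diword [w], which is at
most the leading diword of [h]; hence every composition, being in [Id(S)], is
trivial modulo [S].  The fixed points of [nf] are the claimed normal forms. *)

Require Import Defs.
From HB Require Import structures.
From mathcomp Require Import all_boot all_order all_algebra.
From mathcomp Require Import finmap monalg zify.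
From mathcomp Require Import boolp classical_sets.

Set Implicit Arguments.
Unset Strict Implicit.
Unset Printing Implicit Defensive.

Import Order.TTheory GRing.Theory.

Local Open Scope ring_scope.
Local Open Scope quotient_scope.

(** * Sorting the first letters of a word *)

Section SortPrefix.
Variables (d : Order.disp_t) (X : orderType d).
Implicit Types (s t u v : seq X) (q c : nat).

Definition sort_prefix q u : seq X := sort <=%O (take q u) ++ drop q u.

Lemma perm_sort_prefix q u : perm_eq (sort_prefix q u) u.
Proof. by rewrite -[X in perm_eq _ X](cat_take_drop q) perm_cat2r perm_sort. Qed.

Lemma size_sort_prefix q u : size (sort_prefix q u) = size u.
Proof. exact/perm_size/perm_sort_prefix. Qed.

Lemma sort_prefix_sorted s t : sorted <=%O s -> sort_prefix (size s) (s ++ t) = s ++ t.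
Proof.
by move=> s_le; rewrite /sort_prefix take_size_cat // drop_size_cat // sort_le_id.
Qed.

Lemma sort_prefix_small q u : (q <= 1)%N -> sort_prefix q u = u.
Proof.
case: q => [|[|//]] _; first by rewrite /sort_prefix take0 drop0.
by case: u => [|x u] //; rewrite /sort_prefix /= take0 drop0.
Qed.

Lemma sort_prefix_perm q s s' t :
  perm_eq s s' -> (size s <= q)%N -> sort_prefix q (s ++ t) = sort_prefix q (s' ++ t).
Proof.
move=> ss' sq; rewrite /sort_prefix !take_cat !drop_cat -(perm_size ss') ltnNge sq /=.
by congr (_ ++ _); apply/perm_sort_leP; rewrite perm_cat2r.
Qed.

(** The inner sort permutes letters only inside the prefix that the outer one sorts anyway. For
    [c <= 1] it does nothing, so the bound is required only when [1 < c]. *)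
Lemma sort_prefix_absorb q c s u t : ((1 < c) ==> (size s + c <= q))%N ->
  sort_prefix q (s ++ sort_prefix c u ++ t) = sort_prefix q (s ++ u ++ t).
Proof.
case: ltnP => [_ /= scq|c_le1 _]; last by rewrite (sort_prefix_small _ c_le1).
rewrite -[in RHS](cat_take_drop c u) /sort_prefix -!catA.
rewrite catA [in RHS]catA; apply: sort_prefix_perm.
  by rewrite perm_cat2l perm_sort.
by rewrite size_cat size_sort (leq_trans _ scq) // leq_add2l size_take_min geq_minl.
Qed.

(** The head of the sorted word is the least letter of both words, so either it is strictly smaller
    than the other head or the heads agree and cancel. *)
Lemma sorted_cat_lexi_le s' s t : sorted <=%O s' -> perm_eq s' s ->
  ((s' ++ t : seqlexi X) <= (s ++ t))%O.
Proof.
elim: s' s => [|x s' IHs] [|y s] //=.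
- by move=> _ /perm_size.
- by move=> _ /perm_size.
move=> xs' eq_s; rewrite lexi_cons.
have x_min z : z \in x :: s' -> (x <= z)%O.
  rewrite inE => /predU1P[->//|]; move: xs'; rewrite le_path_sortedE => /andP[/allP + _].
  exact.
have -> /=: (x <= y)%O by apply: x_min; rewrite (perm_mem eq_s) mem_head.
apply/implyP => yx.
have eq_xy : x = y.
  by apply/le_anti; rewrite yx x_min // (perm_mem eq_s) mem_head.
subst y; rewrite perm_cons in eq_s.
by apply: IHs; rewrite // (path_sorted xs').
Qed.

Lemma sort_prefix_lexi_le q u : ((sort_prefix q u : seqlexi X) <= u)%O.
Proof.
rewrite -{2}(cat_take_drop q u); apply: sorted_cat_lexi_le.
  exact: sort_le_sorted.
by rewrite perm_sort.
Qed.

End SortPrefix.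

(** * The normal form map on diwords, its compatibility with both products, and its fixed points *)

Section NormalForm.
Variables (d : Order.disp_t) (X : orderType d).
Implicit Types (v w : diword X).

(** Here [N] is the length and [p] the center of a diword. The test [p.+1 < N] says that at least
    two letters follow the center; it separates the two regimes of [nf]. *)
Definition nf_cut (N p : nat) : nat := if (p.+1 < N)%N then N.-1 else p.-1.
Definition nf_center (N p : nat) : nat := if (p.+1 < N)%N then 1%N else p.

Lemma diword_eq v w : dword v = dword w -> dpos v = dpos w -> v = w.
Proof.
case: v w => [[u m] hm] [[u' m'] hm']; rewrite /dword /dpos /= => eu em.
by apply: val_inj; rewrite /= eu em.
Qed.

Lemma dpos_gt0 w : (0 < dpos w)%N.
Proof. by case/andP: (valP w). Qed.

Lemma dpos_le w : (dpos w <= size (dword w))%N.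
Proof. by case/andP: (valP w). Qed.

(* The sizes are generalized because they occur through different coercions
   from orderType to Type, which lia would take for distinct atoms. *)
Ltac diword_lia :=
  rewrite ?/nf_cut ?/nf_center /=;
  repeat match goal with w : diword _ |- _ =>
    move: (dpos_gt0 w) (dpos_le w); move: (size (dword w)) (dpos w); clear w
  end; intros; do ?case: ifP; lia.

Lemma size_drop_center w : ~~ ((dpos w).+1 < size (dword w))%N ->
  (0 < size (drop (dpos w).-1 (dword w)) <= 2)%N.
Proof. by rewrite size_drop; diword_lia. Qed.

Lemma nf_subproof w :
  (0 < nf_center (size (dword w)) (dpos w)
     <= size (sort_prefix (nf_cut (size (dword w)) (dpos w)) (dword w)))%N.
Proof.
by rewrite size_sort_prefix; diword_lia.
Qed.

Definition nf w : diword X :=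
  @Diword _ (sort_prefix (nf_cut (size (dword w)) (dpos w)) (dword w),
          nf_center (size (dword w)) (dpos w)) (nf_subproof w).

Lemma dword_nf w :
  dword (nf w) = sort_prefix (nf_cut (size (dword w)) (dpos w)) (dword w).
Proof. by []. Qed.

Lemma dpos_nf w : dpos (nf w) = nf_center (size (dword w)) (dpos w).
Proof. by []. Qed.

Lemma size_nf w : size (dword (nf w)) = size (dword w).
Proof. exact: size_sort_prefix. Qed.

Lemma dword_dil v w : dword (dil v w) = dword v ++ dword w.
Proof. by []. Qed.

Lemma dpos_dil v w : dpos (dil v w) = (size (dword v) + dpos w)%N.
Proof. by []. Qed.

Lemma dword_dir v w : dword (dir v w) = dword v ++ dword w.
Proof. by []. Qed.

Lemma dpos_dir v w : dpos (dir v w) = dpos v.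
Proof. by []. Qed.

Let diE := (dword_dil, dpos_dil, dword_dir, dpos_dir, size_cat, size_nf, dword_nf, dpos_nf).

(** The center lies in [w], so the outer cut is at least the length of [v] and covers whatever was
    sorted in [v]. *)
Lemma nf_dill v w : nf (dil (nf v) w) = nf (dil v w).
Proof.
apply: diword_eq; rewrite !diE ?size_sort_prefix //.
apply: (@sort_prefix_absorb _ _ _ _ [::]).
by diword_lia.
Qed.

(** [nf] moves the center of [w] to 1 only when [w] has at least three letters, and then two letters
    still follow it; hence the regime of the product is unchanged. *)
Lemma nf_dilr v w : nf (dil v (nf w)) = nf (dil v w).
Proof.
apply: diword_eq; rewrite !diE ?size_sort_prefix.
  rewrite -[sort_prefix (nf_cut _ (dpos w)) _]cats0 sort_prefix_absorb.
    by rewrite cats0; congr sort_prefix; diword_lia.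
  by diword_lia.
by diword_lia.
Qed.

Lemma nf_dirl v w : nf (dir (nf v) w) = nf (dir v w).
Proof.
apply: diword_eq; rewrite !diE ?size_sort_prefix.
  rewrite (@sort_prefix_absorb _ _ _ _ [::]).
    by congr sort_prefix; diword_lia.
  by diword_lia.
by diword_lia.
Qed.

(** If [nf] sorts more than one letter of [w], then [w] has at least three letters. Two letters then
    follow the center of the product, and all its letters but the last are sorted. *)
Lemma nf_dirr v w : nf (dir v (nf w)) = nf (dir v w).
Proof.
apply: diword_eq; rewrite !diE ?size_sort_prefix //.
rewrite -[sort_prefix (nf_cut _ (dpos w)) _]cats0.
rewrite sort_prefix_absorb ?cats0 //.
by diword_lia.
Qed.

Lemma nf_id w : nf (nf w) = nf w.
Proof.
have cutE : nf_cut (size (dword w)) (nf_center (size (dword w)) (dpos w))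
            = nf_cut (size (dword w)) (dpos w).
  by diword_lia.
apply: diword_eq; last first.
  by rewrite !dpos_nf size_nf; diword_lia.
rewrite (dword_nf (nf w)) size_nf dpos_nf cutE dword_nf.
rewrite -[X in sort_prefix _ X]cats0 (@sort_prefix_absorb _ _ _ _ [::]) /= ?cats0 //.
exact/implyP.
Qed.

(** The two exchanged blocks precede the center, so they lie inside the sorted prefix. *)
Lemma nf_lcl u v w : nf (dil (dil u v) w) = nf (dil (dil v u) w).
Proof.
apply: diword_eq; rewrite !diE [(size (dword v) + _)%N]addnC //.
apply: sort_prefix_perm; first by rewrite perm_catC.
by rewrite size_cat; diword_lia.
Qed.

(** The center lies in the first of three nonempty blocks, so two letters follow it on both sides:
    the centers become 1 and everything but the last letter is sorted. *)
Lemma nf_lcr u v w : nf (dir (dir u v) w) = nf (dir (dir v u) w).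
Proof.
apply: diword_eq; rewrite !diE; last by diword_lia.
have -> : nf_cut (size (dword v) + size (dword u) + size (dword w)) (dpos v)
     = nf_cut (size (dword u) + size (dword v) + size (dword w)) (dpos u).
  by diword_lia.
apply: sort_prefix_perm; first by rewrite perm_catC.
by rewrite size_cat; diword_lia.
Qed.

Lemma N_lcP w : N_lc X w <-> nf w = w.
Proof.
split.
  move=> N_w.
  suff [wordE posE] : dword (nf w) = dword w /\ dpos (nf w) = dpos w by exact: diword_eq.
  rewrite dpos_nf dword_nf; case: N_w => [[s [x [s_le wE pE]]]|[s [x [u [s_le u1 wE pE]]]]].
    rewrite pE wE size_rcons /nf_cut /nf_center; split; last by case: ifP.
    by case: ifP => _; [rewrite -cats1 sort_prefix_sorted | rewrite sort_prefix_small].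
  rewrite pE wE size_cat /= /nf_cut /nf_center.
  have -> /= : ((size s).+2 < size s + (size u).+1)%N = false by lia.
  by rewrite sort_prefix_sorted.
(* The part of the word beyond the cut is the single letter [x] in the first regime, and [x]
   followed by at most one letter in the second. *)
move=> <-; rewrite /N_lc /= dpos_nf dword_nf /nf_cut /nf_center /sort_prefix.
case: ifP => pN; [left | right].
  have : size (drop (size (dword w)).-1 (dword w)) = 1%N.
    by rewrite size_drop; move: pN; diword_lia.
  case: drop => [|x [|]] //= _.
  by exists (sort <=%O (take (size (dword w)).-1 (dword w))), x; rewrite cats1 sort_le_sorted.
have := size_drop_center (negbT pN).
case: drop => [|x u] //= u1.
exists (sort <=%O (take (dpos w).-1 (dword w))), x, u; split=> //.
  exact: sort_le_sorted.
by rewrite size_sort size_take_min; clear pN; diword_lia.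
Qed.

End NormalForm.

(** * Congruences containing the left commutativity relations *)

Section Congruence.
Variables (d : Order.disp_t) (X : orderType d) (R : diword X -> diword X -> Prop).
Hypothesis R_cong : is_congruence R.
Hypothesis R_lcl : forall u v w, R (dil (dil u v) w) (dil (dil v u) w).
Hypothesis R_lcr : forall u v w, R (dir (dir u v) w) (dir (dir v u) w).

Let R_refl w : R w w.
Proof. by case: R_cong. Qed.

Let R_sym v w : R v w -> R w v.
Proof. by case: R_cong => _ + _ _; apply. Qed.

Let R_trans v w z : R v w -> R w z -> R v z.
Proof. by case: R_cong => _ _ + _; apply. Qed.

Lemma diword_exists (u : seq X) m : (0 < m <= size u)%N ->
  {w : diword X | dword w = u /\ dpos w = m}.
Proof. by move=> m_u; exists (@Diword _ (u, m) m_u). Qed.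

(** Exchanges of two adjacent leading blocks generate all permutations, and each such exchange
    before the center is an instance of [R_lcl]. *)
Lemma cong_perm_center_last (s s' t : seq X) (w w' : diword X) : perm_eq s s' ->
  dword w = s ++ t -> dword w' = s' ++ t -> dpos w' = dpos w ->
  (size s < dpos w)%N -> R w w'.
Proof.
move=> ss' wE w'E pE sp; rewrite (perm_size ss') in sp.
refine (@catCA_perm_ind _ (fun s1 => forall w1, dword w1 = s1 ++ t ->
  dpos w1 = dpos w -> (size s1 < dpos w)%N -> R w w1) _ _ _ ss' _ _ w'E pE sp); last first.
  by move=> w1 w1E p1E _; rewrite (_ : w1 = w) //; apply: diword_eq; rewrite ?w1E.
move=> {s s' ss' wE w' w'E pE sp} s1 s2 s3 IH w' w'E pE.
(* An empty block is not the word of a diword, but exchanging it changes nothing. *)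
have [s1E|s1n] := eqVneq s1 [::]; first by subst s1; apply: IH.
have [s2E|s2n] := eqVneq s2 [::]; first by subst s2; apply: IH.
rewrite !size_cat => p_gt; have wle := dpos_le w'.
rewrite w'E !size_cat pE in wle.
have s12_lt : (size s1 + size s2 < dpos w)%N.
  by apply: leq_ltn_trans p_gt; rewrite addnA [X in (X <= _)%N]addnC leq_addr.
(* The centers chosen for [u] and [v] do not matter, as ⊢ keeps only the center of its right factor;
   that of [z] is the old center counted from the end of the two blocks. *)
have [|u [uE upE]] := @diword_exists s1 1; first by case: (s1) s1n.
have [|v [vE vpE]] := @diword_exists s2 1; first by case: (s2) s2n.
have [|z [zE zpE]] := @diword_exists (s3 ++ t) (dpos w - (size s1 + size s2)).
  rewrite size_cat subn_gt0 s12_lt leq_subLR.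
  by apply: leq_trans wle _; rewrite !addnA [(size s2 + _)%N]addnC.
have -> : w' = dil (dil v u) z.
  apply: diword_eq; rewrite ?dword_dil ?dpos_dil ?vE ?uE ?zE ?w'E ?pE -?catA //.
  by rewrite dword_dil vE uE zpE size_cat [(size s2 + _)%N]addnC subnKC // ltnW.
apply: R_trans (R_lcl u v z); apply: IH.
- by rewrite !dword_dil vE uE zE -!catA.
- by rewrite dpos_dil dword_dil vE uE zpE size_cat subnKC // ltnW.
- by rewrite !size_cat addnCA.
Qed.

(** The same block exchanges, now by [R_lcr]. All factors get center 1, so the product has center 1
    whichever block comes first; the fixed last letter [y] keeps the third factor nonempty. *)
Lemma cong_perm_center_first (s s' : seq X) y (w w' : diword X) : perm_eq s s' ->
  dword w = rcons s y -> dword w' = rcons s' y -> dpos w = 1%N -> dpos w' = 1%N ->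
  R w w'.
Proof.
move=> ss' wE w'E pE p'E.
refine (@catCA_perm_ind _ (fun s1 => forall w1, dword w1 = rcons s1 y ->
  dpos w1 = 1%N -> R w w1) _ _ _ ss' _ _ w'E p'E); last first.
  by move=> w1 w1E p1E; rewrite (_ : w1 = w) //; apply: diword_eq; rewrite ?w1E ?p1E.
move=> {s s' ss' wE w' w'E p'E} s1 s2 s3 IH w' w'E p'E.
have [s1E|s1n] := eqVneq s1 [::]; first by subst s1; apply: IH.
have [s2E|s2n] := eqVneq s2 [::]; first by subst s2; apply: IH.
have [|u [uE upE]] := @diword_exists s1 1; first by case: (s1) s1n.
have [|v [vE vpE]] := @diword_exists s2 1; first by case: (s2) s2n.
have [|z [zE zpE]] := @diword_exists (rcons s3 y) 1; first by rewrite size_rcons.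
have -> : w' = dir (dir v u) z.
  apply: diword_eq; first by rewrite !dword_dir vE uE zE w'E !rcons_cat -!catA.
  by rewrite !dpos_dir p'E vpE.
apply: R_trans (R_lcr u v z); apply: IH.
  by rewrite !dword_dir vE uE zE !rcons_cat -!catA.
by rewrite !dpos_dir.
Qed.

(** Write the word as [u v z] with the center at the end of [u]. Exchanging [u] and [v] makes [u] a
    right factor of ⊣, where its center is forgotten; exchanging back with [u'], the same word
    centered at 1, moves the center. *)
Lemma cong_center_first (w w' : diword X) : dword w' = dword w ->
  ((dpos w).+1 < size (dword w))%N -> dpos w' = 1%N -> R w w'.
Proof.
move=> w'E pw p'E; have p0 := dpos_gt0 w.
have [|u [uE upE]] := @diword_exists (take (dpos w) (dword w)) (dpos w).
  by rewrite size_takel ?p0 ?leqnn // dpos_le.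
have [|u' [u'E u'pE]] := @diword_exists (take (dpos w) (dword w)) 1.
  by rewrite size_takel ?p0 // dpos_le.
have [|v [vE vpE]] := @diword_exists (take 1 (drop (dpos w) (dword w))) 1.
  by rewrite size_takel // size_drop subn_gt0 ltnW.
have [|z [zE zpE]] := @diword_exists (drop (dpos w).+1 (dword w)) 1.
  by rewrite size_drop subn_gt0.
have splitE : take (dpos w) (dword w) ++ take 1 (drop (dpos w) (dword w))
               ++ drop (dpos w).+1 (dword w) = dword w.
  by rewrite -[(dpos w).+1]add1n -drop_drop cat_take_drop cat_take_drop.
have wE : w = dir (dir u v) z.
  by apply: diword_eq; rewrite ?dpos_dir // !dword_dir uE vE zE -catA splitE.
have -> : w' = dir (dir u' v) z.
  by apply: diword_eq; rewrite ?dpos_dir ?p'E // !dword_dir u'E vE zE -catA splitE.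
have vuE : dir (dir v u) z = dir (dir v u') z.
  by apply: diword_eq; rewrite ?dpos_dir // !dword_dir uE u'E.
rewrite [X in R X _]wE; apply: R_trans (R_lcr u v z) _.
by rewrite vuE; apply: R_lcr.
Qed.

(** Keeping [R] arbitrary lets this serve both the ideal generated by [T_lc] and the congruence
    [Cong]. *)
Lemma cong_nf w : R w (nf w).
Proof.
have p0 := dpos_gt0 w; have wle := dpos_le w.
have [pN|pN] := boolP ((dpos w).+1 < size (dword w))%N; last first.
  apply: (@cong_perm_center_last (take (dpos w).-1 (dword w))
     (sort <=%O (take (dpos w).-1 (dword w))) (drop (dpos w).-1 (dword w))).
  - by rewrite perm_sym perm_sort.
  - by rewrite cat_take_drop.
  - by rewrite dword_nf /nf_cut (negPf pN).
  - by rewrite dpos_nf /nf_center (negPf pN).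
  - by rewrite size_take_min (leq_ltn_trans (geq_minl _ _)) // prednK.
have [|w1 [w1E p1E]] := @diword_exists (dword w) 1; first by apply: leq_trans pN.
apply: (@R_trans _ w1); first exact: cong_center_first.
have : size (drop (size (dword w)).-1 (dword w)) = 1%N.
  by rewrite size_drop; case: (size _) (pN) => [|n] /= *; rewrite ?subSnn.
case dE : drop => [|y [|]] //= _.
apply: (@cong_perm_center_first (take (size (dword w)).-1 (dword w))
   (sort <=%O (take (size (dword w)).-1 (dword w))) y) => //.
- by rewrite perm_sym perm_sort.
- by rewrite w1E -cats1 -dE cat_take_drop.
- by rewrite dword_nf /nf_cut pN /sort_prefix dE cats1.
- by rewrite dpos_nf /nf_center pN.
Qed.

End Congruence.

(* The cast makes sums of basis vectors use the module structure of [Di] and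
   not the convertible one of [{malg k[diword X]}]. *)
Notation basis_vec k w := (<< w >> : Di k _) (only parsing).

(** * Linear extension of maps defined on diwords *)

Section LinearExtension.
Variables (k : fieldType) (X : choiceType) (V : lmodType k).
Implicit Types (phi psi : diword X -> V) (f g : Di k X) (w : diword X).

Definition lin_ext phi f : V := \sum_(x <- msupp f) f@_x *: phi x.

Lemma lin_extEw (E : {fset diword X}) phi f : (msupp f `<=` E)%fset ->
  lin_ext phi f = \sum_(x <- E) f@_x *: phi x.
Proof.
move=> fE; rewrite /lin_ext (big_fset_incl _ fE) // => x _ xf.
by rewrite mcoeff_outdom // scale0r.
Qed.

Lemma lin_ext_is_linear phi : linear (lin_ext phi).
Proof.
move=> a f g; pose E := (msupp f `|` msupp g)%fset.
rewrite !(@lin_extEw E) ?fsubsetUl ?fsubsetUr //; last first.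
  by apply: fsubset_trans (msuppD_le _ _) (fsetUSS _ (fsubset_refl _)); apply: msuppZ_le.
rewrite scaler_sumr -big_split; apply: eq_bigr => x _ /=.
by rewrite mcoeffD mcoeffZ scalerDl scalerA.
Qed.
HB.instance Definition _ phi :=
  GRing.isLinear.Build k (Di k X) V *:%R (lin_ext phi) (lin_ext_is_linear phi).

Lemma lin_extU phi x : lin_ext phi << x >> = phi x.
Proof. by rewrite /lin_ext msuppU oner_eq0 big_seq_fset1 mcoeffUU scale1r. Qed.

Lemma eq_lin_ext phi psi f : phi =1 psi -> lin_ext phi f = lin_ext psi f.
Proof. by move=> eq_phi; apply: eq_bigr => x _; rewrite eq_phi. Qed.

Lemma lin_ext_eq0 phi f : (forall x, phi x = 0) -> lin_ext phi f = 0.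
Proof. by move=> phi0; apply: big1 => x _; rewrite phi0 scaler0. Qed.

Lemma lin_extB phi psi f :
  lin_ext (fun x => phi x - psi x) f = lin_ext phi f - lin_ext psi f.
Proof. by rewrite /lin_ext -sumrB; apply: eq_bigr => x _; rewrite scalerBr. Qed.

End LinearExtension.

Lemma linear_lin_ext (k : fieldType) (X : choiceType) (V W : lmodType k)
    (L : {linear V -> W}) (phi : diword X -> V) (f : Di k X) :
  L (lin_ext phi f) = lin_ext (fun x => L (phi x)) f.
Proof. by rewrite linear_sum; apply: eq_bigr => x _; rewrite linearZ. Qed.

Lemma basis_vecZ (k : fieldType) (X : choiceType) (c : k) (w : diword X) :
  << c *g w >> = c *: (<< w >> : Di k X).
Proof. by apply/malgP => v; rewrite [RHS]mcoeffZ [LHS]mcoeffU mcoeffU mulr_natr. Qed.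

Lemma lin_ext_basis (k : fieldType) (X : choiceType) (f : Di k X) :
  lin_ext (fun w => << w >> : Di k X) f = f.
Proof. by rewrite [RHS]monalgE; apply: eq_bigr => w _; rewrite -basis_vecZ. Qed.

(** * Bilinear extension of operations on diwords *)

Section Bilinear.
Variables (k : fieldType) (X : choiceType) (op : diword X -> diword X -> diword X).
Implicit Types (v w : diword X) (f g : Di k X).

Lemma bilinE f g :
  bilin op f g = lin_ext (fun v => lin_ext (fun w => << op v w >> : Di k X) g) f.
Proof.
apply: eq_bigr => v _; rewrite scaler_sumr; apply: eq_bigr => w _.
by rewrite basis_vecZ scalerA.
Qed.

Lemma bilinU v w : bilin op << v >> << w >> = << op v w >> :> Di k X.
Proof. by rewrite bilinE !lin_extU. Qed.

Lemma bilinBl f f' g : bilin op (f - f') g = bilin op f g - bilin op f' g.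
Proof. by rewrite !bilinE linearB. Qed.

Lemma bilinBr f g g' : bilin op f (g - g') = bilin op f g - bilin op f g'.
Proof.
by rewrite !bilinE -lin_extB; apply: eq_lin_ext => v; rewrite linearB.
Qed.

(** Inserting [op v' w] gives each summand a factor that is a difference; this is how congruence
    modulo an ideal passes to products. *)
Lemma bilinUB v v' w w' :
  (basis_vec k (op v w) - basis_vec k (op v' w')) =
  bilin op (basis_vec k v - basis_vec k v') (basis_vec k w) +
  bilin op (basis_vec k v') (basis_vec k w - basis_vec k w').
Proof.
have -> : bilin op (basis_vec k v - basis_vec k v') (basis_vec k w) =
    basis_vec k (op v w) - basis_vec k (op v' w).
  by rewrite bilinBl; congr (_ - _); apply: bilinU.
have -> : bilin op (basis_vec k v') (basis_vec k w - basis_vec k w') =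
    basis_vec k (op v' w) - basis_vec k (op v' w').
  by rewrite bilinBr; congr (_ - _); apply: bilinU.
by rewrite subrKA.
Qed.

End Bilinear.

(** * Ideals, the congruences they induce on diwords, and their closure under compositions *)

Section Ideal.
Variables (k : fieldType) (X : choiceType) (I : set (Di k X)).
Hypothesis idealI : is_ideal I.
Implicit Types (f g : Di k X).

Lemma ideal0 : I 0.
Proof. by case: idealI. Qed.

Lemma idealD f g : I f -> I g -> I (f + g).
Proof. by case: idealI => _ IZ _ If Ig; rewrite -[f]scale1r; apply: IZ. Qed.

Lemma idealZ a f : I f -> I (a *: f).
Proof. by case: idealI => I0 IZ _ If; rewrite -[_ *: _]addr0; apply: IZ. Qed.

Lemma idealB f g : I f -> I g -> I (f - g).
Proof. by move=> If Ig; rewrite -scaleN1r; apply/idealD/idealZ. Qed.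

Lemma idealN f : I f -> I (- f).
Proof. by move=> If; rewrite -scaleN1r; apply: idealZ. Qed.

Lemma idealB_trans f g h : I (f - g) -> I (g - h) -> I (f - h).
Proof. by move=> Ifg Igh; rewrite -(subrKA g f (- h)); apply: idealD. Qed.

Lemma ideal_lin_ext (phi : diword X -> Di k X) f :
  (forall w, I (phi w)) -> I (lin_ext phi f).
Proof.
move=> Iphi; rewrite /lin_ext; elim/big_ind: _ => [|g h|w _].
- exact: ideal0.
- exact: idealD.
- exact: idealZ.
Qed.

Lemma ideal_congruence : is_congruence (fun v w => I (basis_vec k v - basis_vec k w)).
Proof.
case: (idealI) => _ _ Imul; split.
- by move=> v; rewrite subrr; apply: ideal0.
- by move=> v w Ivw; rewrite -opprB; apply: idealN.
- by move=> v w z Ivw Iwz; exact: idealB_trans Ivw Iwz.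
move=> v v' w w' Iv Iw.
have [vl _ vr _] := Imul _ << w >> Iv; have [_ wl _ wr] := Imul _ << v' >> Iw.
split; first by rewrite (bilinUB k (@dil X)); exact: (idealD vl wl).
by rewrite (bilinUB k (@dir X)); exact: (idealD vr wr).
Qed.

End Ideal.

Lemma ideal_nsd (k : fieldType) (d : Order.disp_t) (X : orderType d)
    (I : set (Di k X)) (a b : seq X) (s : Di k X) l :
  is_ideal I -> I s -> I (nsd a s b l).
Proof.
case=> _ _ Imul Is.
have I_l u m f : I f -> I (lmull u m f).
  by case: u => [//|x u] If; have [_ If' _ _] := Imul f (mon k (x :: u) m) If; exact: If'.
have I_r u m f : I f -> I (lmulr u m f).
  by case: u => [//|x u] If; have [_ _ _ If'] := Imul f (mon k (x :: u) m) If; exact: If'.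
have r_I u m f : I f -> I (rmull f u m).
  by case: u => [//|x u] If; have [If' _ _ _] := Imul f (mon k (x :: u) m) If; exact: If'.
have r_Ir u m f : I f -> I (rmulr f u m).
  by case: u => [//|x u] If; have [_ _ If' _] := Imul f (mon k (x :: u) m) If; exact: If'.
rewrite /nsd; case: ifP => _; first by apply: r_Ir; apply: I_r.
by case: ifP => _; [apply: r_Ir|apply: r_I]; apply: I_l.
Qed.

(** Each composition is a product with [f] or a difference of two elements built from [f] and [g] by
    multiplication, so no analysis of overlaps is needed. *)
Lemma ideal_composition (k : fieldType) (d : Order.disp_t) (X : orderType d)
    (I : set (Di k X)) (f g h : Di k X) :
  is_ideal I -> I f -> I g -> composition f g h -> I h.
Proof.
move=> idI If Ig; case=> [x _|u _ _|*|*|*|*|*|*];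
  try by apply: (idealB idI) => //; apply: ideal_nsd.
  by case: idI => _ _ Imul; have [_ _ _ If'] := Imul f (mon k [:: x] 1) If; exact: If'.
by case: idI => _ _ Imul; have [If' _ _ _] := Imul f (mon k u (size u)) If; exact: If'.
Qed.

(** * The kernel of the linearized normal form map, and its link with [S_lc] *)

Section NormalFormMap.
Variables (k : fieldType) (d : Order.disp_t) (X : orderType d).
Implicit Types (f g : Di k X) (v w : diword X).
Local Notation NF := (lin_ext (fun w : diword X => basis_vec k (nf w))).

Lemma basis_vec_inj v w : basis_vec k v = basis_vec k w -> v = w.
Proof.
move=> vw; have {vw} : ((v == w)%:R : k) = (w == w)%:R.
  by transitivity (mcoeff w (basis_vec k v)); [rewrite mcoeffU|rewrite vw mcoeffU].
by rewrite eqxx; case: eqP => // _ /eqP; rewrite eq_sym oner_eq0.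
Qed.

Lemma lin_ext_NF (V : lmodType k) (psi : diword X -> V) f :
  (forall w, psi (nf w) = psi w) -> lin_ext psi (NF f) = lin_ext psi f.
Proof.
move=> psi_nf; rewrite (linear_lin_ext (lin_ext psi)).
by apply: eq_lin_ext => w; rewrite /= lin_extU psi_nf.
Qed.

Lemma NF_bilin (op : diword X -> diword X -> diword X) f g :
  NF (bilin op f g) = lin_ext (fun v => lin_ext (fun w => basis_vec k (nf (op v w))) g) f.
Proof.
rewrite bilinE; apply: etrans (linear_lin_ext NF _ _) _; apply: eq_lin_ext => v.
apply: etrans (linear_lin_ext NF _ _) _; apply: eq_lin_ext => w; exact: lin_extU.
Qed.

(** By the hypothesis on [op], the image of the product under [NF] depends on [f] only through
    [NF f]. *)
Lemma NF_bilinl (op : diword X -> diword X -> diword X) f g :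
  (forall v w, nf (op (nf v) w) = nf (op v w)) -> NF f = 0 -> NF (bilin op f g) = 0.
Proof.
move=> nf_op f0; rewrite NF_bilin; apply: etrans (esym (lin_ext_NF _ _)) _ => [v|].
  by apply: eq_lin_ext => w; rewrite nf_op.
by apply: etrans (congr1 (lin_ext _) f0) _; apply: linear0.
Qed.

Lemma NF_bilinr (op : diword X -> diword X -> diword X) f g :
  (forall v w, nf (op v (nf w)) = nf (op v w)) -> NF g = 0 -> NF (bilin op f g) = 0.
Proof.
move=> nf_op g0; rewrite NF_bilin; apply: lin_ext_eq0 => v.
apply: etrans (esym (lin_ext_NF _ _)) _ => [w|]; first by rewrite nf_op.
by apply: etrans (congr1 (lin_ext _) g0) _; apply: linear0.
Qed.

Definition ker_NF : set (Di k X) := [set f | NF f = 0]%classic.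

Lemma ker_NF_ideal : is_ideal ker_NF.
Proof.
rewrite /ker_NF; split=> [|a f g /= f0 g0|f g /= f0] /=.
- exact: linear0.
- by rewrite linearP /= f0 g0 scaler0 addr0.
split.
- exact: (NF_bilinl _ (@nf_dill _ X) f0).
- exact: (NF_bilinr _ (@nf_dilr _ X) f0).
- exact: (NF_bilinl _ (@nf_dirl _ X) f0).
- exact: (NF_bilinr _ (@nf_dirr _ X) f0).
Qed.

Lemma NF_basis_vecB v w :
  ker_NF (basis_vec k v - basis_vec k w) <-> nf v = nf w.
Proof.
have NFE : NF (basis_vec k v - basis_vec k w) = basis_vec k (nf v) - basis_vec k (nf w).
  by apply: etrans (linearB _ _ _) _; congr (_ - _); apply: lin_extU.
rewrite /ker_NF /= NFE; split=> [/eqP|->]; last by rewrite subrr.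
by rewrite subr_eq0 => /eqP/basis_vec_inj.
Qed.

Lemma ker_NF_decomp f : ker_NF f ->
  f = lin_ext (fun w => basis_vec k w - basis_vec k (nf w)) f.
Proof. by move=> f0; rewrite lin_extB [X in _ - X]f0 subr0 lin_ext_basis. Qed.

Lemma mon_basis_vec u m w : dword w = u -> dpos w = m -> mon k u m = basis_vec k w.
Proof. by move=> <- <-; rewrite /mon -surjective_pairing valK. Qed.

(** The two families match the two regimes of [nf]: at most one letter after the center [x], or at
    least two. The bound [2 <= size u] discards only zero polynomials, since shorter words are
    already sorted. *)
Lemma S_lcP f : S_lc k X f <->
  exists2 w, nf w <> w & f = basis_vec k w - basis_vec k (nf w).
Proof.
split=> [[f_n0 Sf]|[w nf_w ->]]; last first.
  split=> [/eqP|]; first by rewrite subr_eq0 => /eqP/basis_vec_inj/esym.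
  have p0 := dpos_gt0 w; have wle := dpos_le w.
  have take_drop m : take m (dword w) ++ drop m (dword w) = dword w by exact: cat_take_drop.
  have [pN|pN] := boolP ((dpos w).+1 < size (dword w))%N; [right|left].
    (* From the center on there are at least three letters, which are read as [x], a nonempty [v],
       and [y]. *)
    have : (2 < size (drop (dpos w).-1 (dword w)))%N.
      by rewrite size_drop ltn_subRL -addSnnS prednK // addn1.
    have := take_drop (dpos w).-1; case: drop => [|x r] //=; case/lastP: r => [|v y] //=.
    rewrite size_rcons !ltnS => wE v1; set u := take _ _ in wE *.
    have su : size u = (dpos w).-1 by rewrite size_takel // (leq_trans (leq_pred _)).
    exists u, v, x, y; split=> //; rewrite su prednK //.
    rewrite (mon_basis_vec (w := w)) //; congr (_ - _); symmetry.
    apply: mon_basis_vec; last by rewrite dpos_nf /nf_center pN.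
    rewrite dword_nf /nf_cut pN -wE -rcons_cons -rcons_cat size_rcons /sort_prefix -cats1 /=.
    by rewrite take_size_cat // drop_size_cat // cats1.
  have := size_drop_center pN.
  have := take_drop (dpos w).-1; case: drop => [|x v] //= wE v1.
  set u := take _ _ in wE *.
  have su : size u = (dpos w).-1 by rewrite size_takel // (leq_trans (leq_pred _)).
  exists u, v, x; rewrite su prednK //; split=> //.
    rewrite leqNgt; apply/negP => u_small; apply: nf_w.
    apply: diword_eq; last by rewrite dpos_nf /nf_center (negPf pN).
    by rewrite dword_nf /nf_cut (negPf pN) sort_prefix_small.
  rewrite (mon_basis_vec (w := w)) //; congr (_ - _); symmetry.
  apply: mon_basis_vec; last by rewrite dpos_nf /nf_center (negPf pN).
  by rewrite dword_nf /nf_cut (negPf pN) /sort_prefix -{2}wE drop_size_cat.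
suff [w fE] : exists w, f = basis_vec k w - basis_vec k (nf w).
  by exists w => // nf_w; apply: f_n0; rewrite fE nf_w subrr.
case: Sf => [[u [v [x [u2 v1 ->]]]]|[u [v [x [y [v1 ->]]]]]].
  have [|w [wE pE]] := @diword_exists _ X (u ++ x :: v) (size u).+1.
    by rewrite size_cat /= addnS ltnS leq_addr.
  have pN : ((size u).+2 < size (u ++ x :: v))%N = false.
    by rewrite size_cat /= addnS ltnS -[(size u).+2]addn2 leq_add2l ltnNge v1.
  exists w; rewrite (mon_basis_vec wE pE); congr (_ - _); apply: mon_basis_vec.
    by rewrite dword_nf wE pE /nf_cut pN /sort_prefix take_size_cat // drop_size_cat.
  by rewrite dpos_nf wE pE /nf_center pN.
have [|w [wE pE]] := @diword_exists _ X (u ++ x :: rcons v y) (size u).+1.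
  by rewrite size_cat /= addnS ltnS leq_addr.
have pN : ((size u).+2 < size (u ++ x :: rcons v y))%N.
  by rewrite size_cat /= size_rcons !addnS !ltnS -{1}[size u]addn0 ltn_add2l.
exists w; rewrite (mon_basis_vec wE pE); congr (_ - _); apply: mon_basis_vec.
  rewrite dword_nf wE pE /nf_cut pN -rcons_cons -rcons_cat size_rcons /sort_prefix -cats1 /=.
  by rewrite take_size_cat // drop_size_cat // cats1.
by rewrite dpos_nf wE pE /nf_center pN.
Qed.

End NormalFormMap.

(** * Leading diwords, and triviality of the elements of the kernel *)

Section Leading.
Variables (k : fieldType) (d : Order.disp_t) (X : orderType d).
Implicit Types (f : Di k X) (v w : diword X).

(** Encodes the deg-lex-center ordering in a lexicographic product, so that the theory of total
    orders applies. *)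
Definition dcenter_key w : (nat *l (seqlexi X *l nat))%type :=
  (size (dword w), (dword w : seqlexi X, dpos w)).

Lemma dcenter_key_inj : injective dcenter_key.
Proof. by move=> v w [_ vw pvw]; apply: diword_eq. Qed.

Lemma dcenter_ltE v w : dcenter_lt v w = (dcenter_key v < dcenter_key w)%O.
Proof.
rewrite /dcenter_lt /deglex_lt !ltxi_pair /= !leEnat !ltEnat /=.
case: ltngtP => [sz|sz|sz] /=; rewrite ?orbF //.
  by apply/negbTE/negP => /andP[/eqP vw _]; rewrite vw ltnn in sz.
by case: (ltgtP (dword v : seqlexi X) (dword w : seqlexi X)).
Qed.

Lemma dcenter_leE v w : dcenter_le v w = (dcenter_key v <= dcenter_key w)%O.
Proof. by rewrite /dcenter_le dcenter_ltE le_eqVlt (inj_eq dcenter_key_inj). Qed.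

Lemma nf_le w : dcenter_le (nf w) w.
Proof.
rewrite dcenter_leE !lexi_pair /= size_nf lexx /=.
rewrite dword_nf sort_prefix_lexi_le /= dpos_nf /nf_center leEnat.
by apply/implyP => _; case: ifP => // _; apply: dpos_gt0.
Qed.

Lemma dcenter_max (s : seq (diword X)) w : w \in s ->
  exists2 m, m \in s & forall v, v \in s -> dcenter_le v m.
Proof.
elim: s w => // x s IHs w _.
case: s IHs => [_|y s IHs].
  by exists x => [|v]; rewrite ?mem_head // inE => /eqP->; rewrite dcenter_leE.
have [m ms m_max] := IHs y (mem_head _ _).
have [xm|mx] := boolP (dcenter_le x m).
  by exists m => [|v]; rewrite inE ?ms ?orbT // => /predU1P[->|/m_max].
exists x => [|v]; rewrite ?mem_head // inE => /predU1P[->|/m_max]; first by rewrite dcenter_leE.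
rewrite !dcenter_leE -ltNge in mx * => vm.
exact: le_trans vm (ltW mx).
Qed.

Lemma lead_eq f w : w \in msupp f -> (forall v, v \in msupp f -> dcenter_le v w) ->
  lead f = Some w.
Proof.
move=> wf w_max; rewrite /lead.
have : w \in [seq z <- msupp f | all (fun v => dcenter_le v z) (msupp f)].
  by rewrite mem_filter wf andbT; apply/allP.
case flt : filter => [|z r] //= _; congr Some.
have : z \in [seq z <- msupp f | all (fun v => dcenter_le v z) (msupp f)] by rewrite flt mem_head.
rewrite mem_filter => /andP[/allP z_max zf]; apply/dcenter_key_inj/le_anti.
by rewrite -!dcenter_leE w_max // z_max.
Qed.

Lemma lead_ge f w : w \in msupp f -> lead_le (Some w) (lead f).
Proof.
move=> wf; have [m mf m_max] := dcenter_max wf.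
by rewrite (lead_eq mf m_max) /=; apply: m_max.
Qed.

Lemma mcoeff_basis_vecB v w z :
  (basis_vec k v - basis_vec k w)@_z = (v == z)%:R - (w == z)%:R.
Proof. by apply: etrans (mcoeffB _ _ _) _; congr (_ - _); apply: mcoeffU. Qed.

Lemma lead_sub_nf w : nf w <> w -> lead (basis_vec k w - basis_vec k (nf w)) = Some w.
Proof.
move=> /eqP nf_w; apply: lead_eq.
  by rewrite -mcoeff_neq0 mcoeff_basis_vecB eqxx (negPf nf_w) subr0 oner_eq0.
move=> v; rewrite -mcoeff_neq0 mcoeff_basis_vecB.
have [<- _|_] := eqVneq w v; first by rewrite dcenter_leE.
have [<- _|_] := eqVneq (nf w) v; first exact: nf_le.
by rewrite subr0 eqxx.
Qed.

Lemma lc_sub_nf w : nf w <> w -> lc (basis_vec k w - basis_vec k (nf w)) = 1.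
Proof.
move=> nf_w; rewrite /lc lead_sub_nf //= mcoeff_basis_vecB eqxx.
by move/eqP/negPf: nf_w => ->; rewrite subr0.
Qed.

(** With empty contexts a polynomial is itself a normal diword; these are the only ones used to
    witness triviality. *)
Lemma nsd_nil (s : Di k X) w : lead s = Some w -> nsd [::] s [::] (dpos w) = s.
Proof.
move=> s_w; rewrite /nsd /lword s_w /= leqNgt dpos_gt0 /=.
by rewrite dpos_le.
Qed.

Lemma ker_NF_trivial_mod f : ker_NF f -> trivial_mod (S_lc k X) f.
Proof.
(* Fixed points of [nf] are left out: their difference is zero, which is not in [S_lc]. *)
move=> f0; pose r := [seq w <- msupp f | nf w != w].
pose w_ i := tnth (in_tuple r) i.
pose s_ w := basis_vec k w - basis_vec k (nf w).
have w_P i : nf (w_ i) <> w_ i /\ w_ i \in msupp f.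
  by have := mem_tnth i (in_tuple r); rewrite mem_filter => /andP[/eqP].
have nsdE i : nsd [::] (s_ (w_ i)) [::] (dpos (w_ i)) = s_ (w_ i).
  by case: (w_P i) => nf_w _; apply/nsd_nil/lead_sub_nf.
exists (size r), (fun i => f@_(w_ i)), (fun=> [::]), (fun=> [::]), (fun i => s_ (w_ i)),
  (fun i => dpos (w_ i)); split.
  move=> i; case: (w_P i) => nf_w wf; split.
  - by apply/S_lcP; exists (w_ i).
  - by rewrite /Pset /lpos (lead_sub_nf nf_w) eqxx.
  - by rewrite nsdE (lead_sub_nf nf_w); apply: lead_ge.
transitivity (\sum_(w <- r) f@_w *: s_ w).
  rewrite {1}(ker_NF_decomp f0) /lin_ext big_filter (bigID (fun w => nf w == w)) /=.
  by rewrite big1 ?add0r // => w /eqP->; rewrite subrr scaler0.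
by rewrite big_tnth; apply: eq_bigr => i _; rewrite nsdE.
Qed.

End Leading.

(** * The generated ideals and congruence, and normal forms in the quotients *)

Section LeftCommutativeQuotient.
Variables (k : fieldType) (d : Order.disp_t) (X : orderType d).
Implicit Types (f : Di k X) (u v w : diword X).
Local Notation ker := (@ker_NF k d X).

Lemma ker_NF_sub_ideal (I : set (Di k X)) : is_ideal I ->
  (forall w, I (basis_vec k w - basis_vec k (nf w))) -> (ker `<=` I)%classic.
Proof.
by move=> idI I_nf f f0; rewrite (ker_NF_decomp f0); apply: (ideal_lin_ext idI).
Qed.

Lemma Id_S_lc : Id (S_lc k X) = ker.
Proof.
apply/seteqP; split=> [f If|].
  apply: If; first exact: ker_NF_ideal.
  by move=> g /S_lcP[w _ ->]; apply/NF_basis_vecB; rewrite nf_id.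
apply: ker_NF_sub_ideal; first exact: Id_is_ideal.
move=> w I idI SI; have [->|/eqP nf_w] := eqVneq (nf w) w.
  by rewrite subrr; apply: (ideal0 idI).
by apply: SI; apply/S_lcP; exists w.
Qed.

Lemma bilin2U (op : diword X -> diword X -> diword X) u v w :
  bilin op (bilin op << u >> << v >>) << w >> = basis_vec k (op (op u v) w).
Proof.
by apply: etrans (congr1 (fun f => bilin op f << w >>) (bilinU k op u v)) _; apply: bilinU.
Qed.

Lemma T_lcl u v w :
  T_lc k X (basis_vec k (dil (dil u v) w) - basis_vec k (dil (dil v u) w)).
Proof.
exists u, v, w; left; rewrite -[X in X - _](bilin2U (@dil X)).
by rewrite -[X in _ - X](bilin2U (@dil X)).
Qed.

Lemma T_lcr u v w :
  T_lc k X (basis_vec k (dir (dir u v) w) - basis_vec k (dir (dir v u) w)).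
Proof.
exists u, v, w; right; rewrite -[X in X - _](bilin2U (@dir X)).
by rewrite -[X in _ - X](bilin2U (@dir X)).
Qed.

Lemma T_lc_ker f : T_lc k X f -> ker f.
Proof.
case=> u [v [w [->|->]]].
  rewrite [X in X - _](bilin2U (@dil X)) [X in _ - X](bilin2U (@dil X)).
  exact/NF_basis_vecB/nf_lcl.
rewrite [X in X - _](bilin2U (@dir X)) [X in _ - X](bilin2U (@dir X)).
exact/NF_basis_vecB/nf_lcr.
Qed.

Lemma Id_T_lc : Id (T_lc k X) = ker.
Proof.
apply/seteqP; split=> [f If|].
  by apply: If; [exact: ker_NF_ideal|exact: T_lc_ker].
have idI := Id_is_ideal (T_lc k X); apply: ker_NF_sub_ideal => // w.
apply: (cong_nf (ideal_congruence idI)) => u v z I _; apply.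
  exact: T_lcl.
exact: T_lcr.
Qed.

(** Having equal normal forms is itself a congruence containing the relations, by way of the ideal
    [ker]; conversely [cong_nf] links each diword to its normal form. *)
Lemma Cong_T_lcP v w : Cong (T_lc k X) v w <-> nf v = nf w.
Proof.
split=> [C|vw].
  apply/(NF_basis_vecB k); apply: C (ideal_congruence (ker_NF_ideal k X)) _ => p q.
  exact: T_lc_ker.
have Cnf z : Cong (T_lc k X) z (nf z).
  move=> R cR TR; apply: (cong_nf cR) => *; apply: TR; [exact: T_lcl|exact: T_lcr].
move=> R cR TR; case: (cR) => _ Rsym Rtrans _.
apply: Rtrans (Cnf v R cR TR) _; rewrite vw; apply: Rsym; exact: Cnf.
Qed.

Lemma S_lc_GS_basis : GS_basis (S_lc k X).
Proof.
split=> [f /S_lcP[w nf_w ->]|f g h Sf Sg fgh]; first exact: lc_sub_nf.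
apply: ker_NF_trivial_mod; rewrite -Id_S_lc.
by apply: ideal_composition fgh; [exact: Id_is_ideal|move=> I _; apply|move=> I _; apply].
Qed.

Lemma N_lc_basis : is_basis (V := Di_quot (T_lc k X)) (N_lc X)
  (fun w => \pi_(Di_quot (T_lc k X)) << w >>).
Proof.
have lin_pi (r : seq (diword X)) (c : diword X -> k) :
    \sum_(w <- r) c w *: \pi_(Di_quot (T_lc k X)) (basis_vec k w) =
    \pi_(Di_quot (T_lc k X)) (\sum_(w <- r) c w *: basis_vec k w).
  rewrite raddf_sum; apply: eq_bigr => w _; symmetry; exact: pi_scaleq.
split=> [v w /N_lcP nfv /N_lcP nfw /pi_eqP|q|r c r_uniq rN].
- by rewrite Id_T_lc => /NF_basis_vecB; rewrite nfv nfw.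
- rewrite -[q]reprK; move: (repr q) => f {q}.
  (* The expansion of [NF f] serves: it involves only normal diwords and differs from [f] by an
     element of the kernel. *)
  pose g := lin_ext (fun w => basis_vec k (nf w)) f.
  exists (msupp g), (fun w => g@_w); split=> [w|].
    rewrite -mcoeff_neq0 /g /lin_ext => g_w; apply/N_lcP.
    apply/eqP; apply: contra_neqT g_w => nf_w.
    rewrite raddf_sum big1 // => v _ /=; rewrite mcoeffZ mcoeffU.
    have [vw|] := eqVneq (nf v) w; last by rewrite mulr0.
    by rewrite -vw nf_id eqxx in nf_w.
  have gE : \sum_(w <- msupp g) g@_w *: basis_vec k w = g := lin_ext_basis g.
  rewrite lin_pi gE.
  apply/pi_eqP; rewrite Id_T_lc -{1}(lin_ext_basis f) /g -lin_extB.
  apply: (ideal_lin_ext (ker_NF_ideal k X)) => w; apply/NF_basis_vecB.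
  by rewrite nf_id.
rewrite lin_pi => /eqP; rewrite -(raddf0 (\pi_(Di_quot (T_lc k X)))) => /eqP/pi_eqP.
rewrite Id_T_lc subr0 /ker_NF /= => sum0 w wr.
(* Members of [r] are fixed by [nf], so [NF] leaves the combination unchanged and its coefficient at
   [w] is [c w]. *)
have coefE v : v \in r ->
    c v * (v == w)%:R = mcoeff w (lin_ext (fun w => basis_vec k (nf w)) (c v *: basis_vec k v)).
  move=> vr; rewrite linearZ /= lin_extU ((N_lcP v).1 (rN v vr)).
  by symmetry; apply: etrans (mcoeffZ _ _ _) _; rewrite mcoeffU.
have : \sum_(v <- r) c v * (v == w)%:R = 0.
  rewrite (eq_big_seq _ coefE) -raddf_sum -linear_sum.
  by apply: etrans (congr1 (mcoeff w) sum0) _; apply: mcoeff0.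
rewrite (big_rem w wr) /= eqxx mulr1 big_seq big1 ?addr0 // => v.
by rewrite mem_rem_uniq // inE => /andP[/negPf-> _]; rewrite mulr0.
Qed.

Lemma N_lc_normal_form (q : Disgp (T_lc k X)) :
  exists! w : diword X, N_lc X w /\ \pi_(Disgp (T_lc k X)) w = q.
Proof.
have piP v w : \pi_(Disgp (T_lc k X)) v = \pi_(Disgp (T_lc k X)) w <-> nf v = nf w.
  split=> [/eqmodP/asboolP/Cong_T_lcP//|vw].
  by apply/eqmodP/asboolP/Cong_T_lcP.
exists (nf (repr q)); split=> [|w [/N_lcP nf_w qw]].
  split; first by apply/N_lcP; apply: nf_id.
  by rewrite -[RHS]reprK; apply/piP; apply: nf_id.
by rewrite -nf_w; apply/piP; rewrite reprK.
Qed.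

End LeftCommutativeQuotient.

Theorem proposition5p11 (k : fieldType) (d : Order.disp_t) (X : orderType d)
    (X_wo : well_ordered X) :
  [/\ Id (T_lc k X) = Id (S_lc k X),
      GS_basis (S_lc k X),
      is_basis (V := Di_quot (T_lc k X)) (N_lc X)
        (fun w => \pi_(Di_quot (T_lc k X)) << w >>) &
      forall q : Disgp (T_lc k X),
        exists! w : diword X, N_lc X w /\ \pi_(Disgp (T_lc k X)) w = q].
Proof.
split.
- by rewrite Id_T_lc Id_S_lc.
- exact: S_lc_GS_basis.
- exact: N_lc_basis.
- exact: N_lc_normal_form.
Qed.
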